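(* Let $K$ be a field and let $P\subset K[x_1,\dots,x_n]$ be a monomial prime. Then $P$ is an associated prime of $(I(H)^\vee)^2$ for some 3-hypergraph $H$ of size $n$ (with vertex set $\{x_1,\dots,x_n\}$) if and only if $\operatorname{height}(P)\ge 3$.
   Context: A 3-hypergraph $H$ of size $n$ consists of a vertex set $\{x_1,\dots,x_n\}$ and an edge set $E$ whose elements are subsets of the vertex set with exactly 3 distinct elements. The vertices are identified with the variables of $K[x_1,\dots,x_n]$. The edge ideal $I(H)$ is the ideal generated by the monomials $x_ix_jx_k$ with $\{x_i,x_j,x_k\}\in E$. Its Alexander dual is $I(H)^\vee=\bigcap_{\{x_i,x_j,x_k\}\in E}(x_i,x_j,x_k)$ (an empty intersection being the whole ring, which has no associated primes). A monomial prime is a prime ideal generated by monomials, i.e. by a subset of the variables. An associated prime of an ideal $J$ of a ring $R$ means an associated prime of $R/J$. *)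

(* Defs.v *)
From HB Require Import structures.
From mathcomp Require Import all_boot all_order all_algebra.
From mathcomp Require Import boolp classical_sets.
From mathcomp Require Import mpoly.

Set Implicit Arguments.
Unset Strict Implicit.
Unset Printing Implicit Defensive.

Import GRing.Theory.
Local Open Scope classical_set_scope.
Local Open Scope ring_scope.

Section Ideals.
Variable R : comNzRingType.
Implicit Types I J P S : set R.

(* Unlike [idealr_closed] of ring_quotient, this allows the unit ideal. *)
Definition ideal I : Prop :=
  I 0 /\ forall a u v, I u -> I v -> I (a * u + v).

Definition ideal_gen S : set R := smallest ideal S.

Definition ideal_mul I J : set R := ideal_gen [set u * v | u in I & v in J].

Definition prime_ideal P : Prop :=
  idealr_closed (mem P) /\ prime_idealr_closed (mem P).

(* P is the annihilator of the class of f in R/J. *)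
Definition associated_prime J P : Prop :=
  prime_ideal P /\ exists f : R, P = [set g | J (g * f)].

(* A strict chain p 0 < p 1 < ... < p h = P of prime ideals, of length h. *)
Definition prime_chain P (h : nat) (p : nat -> set R) : Prop :=
  [/\ forall i, (i <= h)%N -> prime_ideal (p i),
      forall i, (i < h)%N -> p i `<` p i.+1
    & p h = P].

(* height P >= k, the height being the supremum, possibly infinite, of the
   lengths of the chains of prime ideals ending at P. *)
Definition height_ge P (k : nat) : Prop :=
  exists2 h, (k <= h)%N & exists p, prime_chain P h p.

End Ideals.

Record hypergraph3 (n : nat) := Hypergraph3 {
  hedges : {set {set 'I_n}};
  hedges_card3 : forall e, e \in hedges -> #|e| = 3%N
}.

Section MonomialIdeals.
Variables (K : fieldType) (n : nat).

Definition monomial_prime (P : set {mpoly K[n]}) : Prop :=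
  prime_ideal P /\
  exists M : set 'X_{1..n},
    P = ideal_gen [set ('X_[m] : {mpoly K[n]}) | m in M].

Definition vars_ideal (e : {set 'I_n}) : set {mpoly K[n]} :=
  ideal_gen [set ('X_i : {mpoly K[n]}) | i in [set` e]].

(* The Alexander dual of the edge ideal of H; the empty intersection is the
   whole ring. *)
Definition edge_ideal_dual (H : hypergraph3 n) : set {mpoly K[n]} :=
  \bigcap_(e in [set` hedges H]) vars_ideal e.

End MonomialIdeals.

Arguments edge_ideal_dual K {n} H _.

(* Main.v *)
From HB Require Import structures.
Require Import Defs.
From mathcomp Require Import all_boot all_order all_algebra.
From mathcomp Require Import boolp classical_sets.
From mathcomp Require Import mpoly zify ring.

(** A monomial prime is the ideal P_S generated by a set S of variables
([monomial_prime_vars]), and its height is at least 3 if and only if S has at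
least three elements.  The lower bound is the obvious chain of prefixes
([height_vars_ideal_ge]).  For the upper bound, suppose that S has at most two
elements and that p1 < p2 < P_S with p1 nonzero.  Eliminating a variable x_j
between an element of p1 and one of p2 outside p1 (pseudo-division with
respect to x_j) gives a nonzero element of p2 free of x_j ([elimination]).  If
S = {i, j}, that element lies in P_S and is free of x_j, so it is a multiple
of x_i; dividing by x_i as often as possible shows that x_i is in p2
([mem_var_of_free]).  If S = {i}, any nonzero element of p2 serves instead.
Hence every variable of S lies in p2, and p2 = P_S.

The dual J of I(H) and its square are monomial ideals: x^m lies in J when the
variables dividing x^m meet every edge of H, and in J^2 when H has two
transversals C1, C2 whose indicator functions add up to at most m
([edge_ideal_dual_sqE]).

If S has at most two elements, no edge is contained in S, so the complement of
S is a transversal, and the square of the product of its variables is an element of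
J^2 outside P_S: thus P_S is not associated to J^2 ([associated_prime_card]).

If S has s >= 3 elements, a hypergraph H on S and a monomial x^a are needed
with x^a not in J^2 but x_i x^a in J^2 for all i in S; then J^2 : x^a = P_S
([associated_prime_vars]).  For s = 3 take the single edge S and x^a = x_i for any i in S.
For s >= 4 let L be the odd number among s - 1 and s - 2, let v_0, ..., v_(s-1)
enumerate S, and take the edges {v_k, v_(k+1), v_L} for k < L - 1 together with
{v_(L-1), v_0, v_(s-1)}, and x^a = v_0 ... v_(L-1).  Two transversals
witnessing x^a in J^2 would avoid the apexes v_L and v_(s-1) and hence give a
proper 2-colouring of the odd cycle v_0, ..., v_(L-1).  Multiplying x^a by any
vertex destroys this obstruction ([cycle_critical]). *)

Set Implicit Arguments.
Unset Strict Implicit.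
Unset Printing Implicit Defensive.

Import GRing.Theory.

(** * Critical monomials of 3-hypergraphs *)

(** [C] meets every edge in [E]. *)
Definition transversal (n : nat) (E : {set {set 'I_n}}) (C : {set 'I_n}) : Prop :=
  forall e, e \in E -> exists2 i, i \in e & i \in C.

(** Two transversals fit into the multiset [m]; for the edge set [E] of H this
says that x^m lies in the square of the dual of I(H). *)
Definition doubly_covered (n : nat) (E : {set {set 'I_n}}) (m : 'X_{1..n}) : Prop :=
  exists C1 C2 : {set 'I_n},
    [/\ transversal E C1, transversal E C2
      & forall i, (i \in C1) + (i \in C2) <= m i].

(** The combinatorial form of J^2 : x^a = P_S, for J the dual of the edge ideal
of a hypergraph with edge set [E], all of whose edges lie in [S]. *)
Definition critical (n : nat) (E : {set {set 'I_n}}) (S : {set 'I_n}) (a : 'X_{1..n}) : Prop :=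
  [/\ forall e, e \in E -> e \subset S, ~ doubly_covered E a
    & forall i, i \in S -> doubly_covered E (a + U_(i))%MM].

Lemma critical_single n (S : {set 'I_n}) (i0 : 'I_n) :
  i0 \in S -> critical [set S] S U_(i0)%MM.
Proof.
move=> Si0; split=> [e /set1P-> //||i Si].
- case=> C1 [C2 [T1 T2 le]].
  have [i _ C1i] := T1 S (set11 S); have [j _ C2j] := T2 S (set11 S).
  have := le i; have := le j; rewrite C1i C2j !mnm1E.
  have [<-|_] := eqVneq i0 i; last by case: (i \in C2).
  have [E|_] := eqVneq i0 j; last by case: (j \in C1).
  by rewrite E C2j.
exists [set i0], [set i]; split.
- by move=> e /set1P->; exists i0; rewrite ?set11.
- by move=> e /set1P->; exists i; rewrite ?set11.
by move=> j; rewrite mnmDE !mnm1E !inE ![j == _]eq_sym.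
Qed.

(** The vertices of [S] are enumerated as v 0, ..., v (#|S| - 1); the first [L]
of them, an odd number, form a cycle. *)
Section OddCycle.
Variables (n : nat) (S : {set 'I_n}) (i0 : 'I_n) (L : nat).
Hypotheses (oddL : odd L) (L_gt2 : 2 < L) (ltLS : L < #|S| <= L.+2).

Let v k := nth i0 (enum S) k.
Let idx i := index i (enum S).

(** The successor of [k] on the cycle. *)
Definition next k := if k.+1 == L then 0 else k.+1.

(** The position of the third vertex of the k-th edge; the last edge of the
cycle has the apex #|S| - 1, which differs from the common apex [L] of the
other edges exactly when #|S| is odd. *)
Definition apex k := if k.+1 == L then #|S|.-1 else L.
Definition cycle_edge k := [set v k; v (next k); v (apex k)].
Definition cycle_edges : {set {set 'I_n}} :=
  [set cycle_edge k | k : 'I_L].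
Definition cycle_monomial : 'X_{1..n} :=
  [multinom ((i \in S) && (idx i < L) : nat) | i < n].

Let vS k : k < #|S| -> v k \in S.
Proof. by move=> lt; rewrite -mem_enum mem_nth // -cardE. Qed.

Let idxv k : k < #|S| -> idx (v k) = k.
Proof. by move=> lt; rewrite /idx /v index_uniq ?enum_uniq -?cardE. Qed.

Let vidx i : i \in S -> v (idx i) = i.
Proof. by move=> Si; rewrite /v /idx nth_index ?mem_enum. Qed.

Let idx_lt i : i \in S -> idx i < #|S|.
Proof. by move=> Si; rewrite /idx cardE index_mem mem_enum. Qed.

Let v_inj j k : j < #|S| -> k < #|S| -> (v j == v k) = (j == k).
Proof. by move=> lj lk; rewrite nth_uniq ?enum_uniq -?cardE. Qed.

Let next_lt k : k < L -> next k < L.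
Proof. by rewrite /next; case: eqP; lia. Qed.

Let apex_bounds k : L <= apex k < #|S|.
Proof. by rewrite /apex; case: eqP; lia. Qed.

Lemma cycle_edges_card3 e : e \in cycle_edges -> #|e| = 3.
Proof.
case/imsetP=> [[k ltk] _ ->] /=; rewrite /cycle_edge.
have ltn := next_lt ltk; have /andP[lea lta] := apex_bounds k.
have neq : k != next k by rewrite /next; case: ifP; lia.
have lk : k < #|S| by lia.
have ln : next k < #|S| by lia.
rewrite -finset.setUA !cardsU1 cards1 !inE !v_inj //. lia.
Qed.

Lemma cycle_edges_sub e : e \in cycle_edges -> e \subset S.
Proof.
case/imsetP=> [[k ltk] _ ->] /=.
have ltn := next_lt ltk; have /andP[lea lta] := apex_bounds k.
by apply/fintype.subsetP=> i; rewrite !inE => /orP[/orP[]|] /eqP->; apply: vS; lia.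
Qed.

(** Transversals contained in [S] are described by a predicate on positions. *)
Let transversal_idx (Q : pred nat) :
  (forall k, k < L -> [|| Q k, Q (next k) | Q (apex k)]) ->
  transversal cycle_edges [set i in S | Q (idx i)].
Proof.
move=> HQ e /imsetP[[k ltk] _ ->] /=.
have ltn := next_lt ltk; have /andP[lea lta] := apex_bounds k.
have lk : k < #|S| by lia.
have ln : next k < #|S| by lia.
case/or3P: (HQ k ltk) => Qk; [exists (v k)|exists (v (next k))|exists (v (apex k))];
  by rewrite ?inE ?eqxx ?orbT ?idxv ?vS.
Qed.

Let doubly_covered_idx (Q1 Q2 : pred nat) i : i \in S ->
  (forall k, k < L -> [|| Q1 k, Q1 (next k) | Q1 (apex k)]) ->
  (forall k, k < L -> [|| Q2 k, Q2 (next k) | Q2 (apex k)]) ->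
  (forall k, k < #|S| -> Q1 k + Q2 k <= (k < L) + (k == idx i)) ->
  doubly_covered cycle_edges (cycle_monomial + U_(i))%MM.
Proof.
move=> Si H1 H2 le.
exists [set i in S | Q1 (idx i)], [set i in S | Q2 (idx i)].
split; try exact: transversal_idx.
move=> j; rewrite !inE mnmDE mnm1E mnmE; have [Sj|//] := boolP (j \in S) => /=.
have := le _ (idx_lt Sj); suff -> : (idx j == idx i) = (i == j) by [].
by apply/eqP/eqP => [eq|-> //]; rewrite -(vidx Si) -eq vidx.
Qed.

(** Membership in one of two transversals fitting into [cycle_monomial] would
alternate along a cycle of odd length. *)
Lemma cycle_not_doubly_covered : ~ doubly_covered cycle_edges cycle_monomial.
Proof.
case=> C1 [C2 [T1 T2 le]].
have disj i : ~~ ((i \in C1) && (i \in C2)).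
  apply/negP=> /andP[h1 h2]; have := le i.
  by rewrite h1 h2 mnmE; case: (_ && _).
have apexN k C : C = C1 \/ C = C2 -> v (apex k) \notin C.
  have /andP[lea lta] := apex_bounds k.
  have := le (v (apex k)).
  rewrite mnmE vS // idxv // [_ < L]ltnNge lea leqn0 addn_eq0 !eqb0.
  by case/andP=> ? ? [->|->].
have cov C k : C = C1 \/ C = C2 -> k < L -> (v k \in C) || (v (next k) \in C).
  move=> CC ltk; have T : transversal cycle_edges C by case: CC => ->.
  have [|i] := T (cycle_edge k); first by apply/imsetP; exists (Ordinal ltk).
  rewrite !inE => /orP[/orP[]|] /eqP-> h; rewrite ?h ?orbT //.
  by have := apexN k C CC; rewrite h.
have alt k : k < L -> (v (next k) \in C1) = (v k \notin C1).
  move=> ltk; have := cov C1 k (or_introl erefl) ltk.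
  have := cov C2 k (or_intror erefl) ltk.
  have := disj (v k); have := disj (v (next k)).
  by case: (v k \in C1); case: (v k \in C2); case: (_ \in C1); case: (_ \in C2).
have parity k : k < L -> (v k \in C1) = odd k (+) (v 0 \in C1).
  elim: k => [|k IH] ltk //=.
  have := alt k (ltnW ltk); rewrite /next ifN; last by lia.
  by move->; rewrite IH ?addNb // ltnW.
have := alt L.-1; rewrite /next prednK; last by lia.
rewrite eqxx (parity L.-1); last by lia.
have -> : odd L.-1 = false by move: oddL; case: L => //= l /negbTE.
by case: (v 0 \in C1) => /(_ ltac:(lia)).
Qed.

Lemma cycle_critical : critical cycle_edges S cycle_monomial.
Proof.
split; [exact: cycle_edges_sub|exact: cycle_not_doubly_covered|move=> i Si].
have lti := idx_lt Si.
have [ltiL|leLi] := ltnP (idx i) L.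
- (* Both transversals contain the doubled vertex v_i; the remaining path
     v_(i+1), ..., v_(L-1), v_0, ..., v_(i-1) is coloured alternately, the
     parity being shifted after i because L is odd. *)
  apply: (doubly_covered_idx (Q1 := fun k => (k < L) && ((k == idx i) || (odd k (+) (idx i < k))))
    (Q2 := fun k => (k < L) && ((k == idx i) || ~~ (odd k (+) (idx i < k))))) => //.
  + move=> k ltk; rewrite /apex /next ltk; case: (k.+1 =P L) => /= E; last by have := oddS k; lia.
    have : odd k = false by move: oddL; rewrite -E /= => /negbTE.
    lia.
  + move=> k ltk; rewrite /apex /next ltk; case: (k.+1 =P L) => /= E; last by have := oddS k; lia.
    have : odd k = false by move: oddL; rewrite -E /= => /negbTE.
    lia.
  + by move=> k ltk; lia.
have [eqiL|neqiL] := eqVneq (idx i) L.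
- (* {v_L, v_0} is a transversal, as all edges but the last contain v_L and the
     last contains v_0; so is {v_1, ..., v_(L-1)}. *)
  apply: (doubly_covered_idx (Q1 := fun k => (k == L) || (k == 0))
    (Q2 := fun k => 0 < k < L)) => // k ltk.
  + by rewrite /next /apex; case: (k.+1 =P L); lia.
  + by rewrite /next /apex; case: (k.+1 =P L); lia.
  + by lia.
(* The alternating colouring fails only on the last edge, which has v_i as apex. *)
have eqis : idx i = #|S|.-1 by lia.
apply: (doubly_covered_idx (Q1 := fun k => (k < L) && ~~ odd k)
  (Q2 := fun k => (k < L) && odd k || (k == #|S|.-1))) => // k ltk.
- rewrite /next /apex; case: (k.+1 =P L) => E; have := oddS k; lia.
- rewrite /next /apex; case: (k.+1 =P L) => E; have := oddS k; lia.
- by lia.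
Qed.
End OddCycle.

Lemma critical_exists n (S : {set 'I_n}) : 2 < #|S| ->
  exists (H : hypergraph3 n) (a : 'X_{1..n}), critical (hedges H) S a.
Proof.
move=> S_gt2; have [i0 Si0] : exists i, i \in S.
  by apply/set0Pn; rewrite -card_gt0; lia.
have [/eqP S3|S_neq3] := eqVneq #|S| 3.
  have card3 e : e \in [set S] -> #|e| = 3 by move/set1P->; exact/eqP.
  by exists (Hypergraph3 card3), U_(i0)%MM; exact: critical_single.
pose L := if odd #|S| then #|S|.-2 else #|S|.-1.
have oddL : odd L by rewrite /L; case: ifP; lia.
have L_gt2 : 2 < L by rewrite /L; case: ifP; lia.
have ltLS : L < #|S| <= L.+2 by rewrite /L; case: ifP; lia.
exists (Hypergraph3 (cycle_edges_card3 oddL L_gt2 ltLS (i0 := i0))), (cycle_monomial S L).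
exact: cycle_critical.
Qed.

Local Open Scope classical_set_scope.
Local Open Scope ring_scope.

(** * Ideals *)

Section IdealTheory.
Variable R : comNzRingType.
Implicit Types (I P : set R) (u v : R).

Lemma ideal_add I u v : ideal I -> I u -> I v -> I (u + v).
Proof. by move=> [_ iD] Iu Iv; rewrite -[u]mul1r; exact: iD. Qed.

Lemma ideal_mull I u v : ideal I -> I v -> I (u * v).
Proof. by move=> [i0 iD] Iv; rewrite -[_ * _]addr0; exact: iD. Qed.

Lemma ideal_sub I u v : ideal I -> I u -> I v -> I (u - v).
Proof.
by move=> hI Iu Iv; apply: ideal_add => //; rewrite -mulN1r; exact: ideal_mull.
Qed.

Lemma ideal_sum I (T : eqType) (r : seq T) (F : T -> R) :
  ideal I -> (forall x, x \in r -> I (F x)) -> I (\sum_(x <- r) F x).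
Proof.
move=> hI IF; rewrite big_seq; elim/big_ind: _ => //; first by case: hI.
by move=> u v; exact: ideal_add.
Qed.

Lemma ideal_gen_ideal (S : set R) : ideal (ideal_gen S).
Proof.
split=> [|a u v Su Sv] J [hJ SJ]; first by case: hJ.
by case: (hJ) => _; apply; [exact: Su|exact: Sv].
Qed.

Lemma prime_idealP P :
  prime_ideal P <->
  [/\ ideal P, ~ P 1 & forall u v, P (u * v) -> P u \/ P v].
Proof.
split=> [[[P0 P1 PD] PM]|[[P0 PD] P1 PM]].
  split=> [|P1'|u v Puv].
  - split=> [|a u v Pu Pv]; first exact: set_mem P0.
    exact: set_mem (PD a u v (mem_set Pu) (mem_set Pv)).
  - by move/negP: P1; apply; exact: mem_set.
  - by case/orP: (PM u v (mem_set Puv)) => h; [left|right]; exact: set_mem h.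
split; first split.
- exact: mem_set.
- by apply/negP => /set_mem.
- by move=> a u v /set_mem Pu /set_mem Pv; apply: mem_set; exact: PD.
by move=> u v /set_mem/PM[h|h]; apply/orP; [left|right]; exact: mem_set.
Qed.

End IdealTheory.

(** * Monomial ideals and the square of the dual edge ideal *)

Section MonomialIdealTheory.
Variables (K : fieldType) (n : nat).
Implicit Types (D : set 'X_{1..n}) (S : {set 'I_n}) (f g : {mpoly K[n]}).

(** The span of the monomials with exponent in [D]; it is an ideal when [D] is
upward closed. *)
Definition monomial_ideal D : set {mpoly K[n]} :=
  [set f | forall m, m \in msupp f -> D m].

Definition upward D := forall m m', D m -> D (m + m')%MM.

Lemma monomial_ideal_ideal D : upward D -> ideal (monomial_ideal D).
Proof.
move=> upD; split=> [m|a u v Du Dv m]; first by rewrite msupp0.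
move/msuppD_le; rewrite mem_cat => /orP[|]; last exact: Dv.
by move/msuppM_le/allpairsP=> [[m1 m2] /= [_ /Du Dm2 ->]]; rewrite addmC; exact: upD.
Qed.

Lemma monomial_idealX D m : monomial_ideal D 'X_[m] <-> D m.
Proof.
by split=> [|Dm m']; [apply; rewrite msuppX mem_head|rewrite msuppX inE => /eqP->].
Qed.

Lemma monomial_ideal_sub D I : ideal I ->
  (forall m, D m -> I 'X_[m]) -> monomial_ideal D `<=` I.
Proof.
move=> hI DI f Df; rewrite [f]mpolyE; apply: ideal_sum => // m /Df Dm.
by rewrite -mul_mpolyC; apply: ideal_mull => //; exact: DI.
Qed.

Lemma monomial_ideal_colon D (a : 'X_{1..n}) :
  [set g | monomial_ideal D (g * 'X_[a])] =
  monomial_ideal [set m | D (m + a)%MM].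
Proof.
apply/seteqP; split=> g /= Dg m.
- move=> gm; apply: Dg; rewrite (perm_mem (msuppMX _ _)).
  by rewrite -[X in X \in _]/(m + a)%MM addmC map_f.
- rewrite (perm_mem (msuppMX _ _)) => /mapP[m' /Dg /=]; rewrite addmC => h ->.
  exact: h.
Qed.

(** The exponents of the monomials divisible by some variable of [S]. *)
Definition meets S : set 'X_{1..n} := [set m | exists2 i, i \in S & (0 < m i)%N].

Lemma meets_upward S : upward (meets S).
Proof. by move=> m m' [i Si mi]; exists i => //; rewrite mnmDE ltn_addr. Qed.

Lemma vars_ideal_ideal S : ideal (@vars_ideal K n S).
Proof. exact: (ideal_gen_ideal (R := {mpoly K[n]})). Qed.

Lemma vars_ideal_X S i : i \in S -> @vars_ideal K n S 'X_i.
Proof. by move=> Si J [_]; apply; exists i. Qed.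

Lemma mpolyX_dvd (m : 'X_{1..n}) i : (0 < m i)%N ->
  'X_[m] = 'X_[m - U_(i)] * 'X_i :> {mpoly K[n]}.
Proof.
move=> mi; rewrite -mpolyXD submK //; apply/mnm_lepP => j; rewrite mnm1E.
by case: eqP => // <-.
Qed.

Lemma vars_idealE S : @vars_ideal K n S = monomial_ideal (meets S).
Proof.
apply/seteqP; split.
- apply: smallest_sub; first exact: (monomial_ideal_ideal (@meets_upward S)).
  by move=> _ [i Si <-]; apply/monomial_idealX; exists i => //; rewrite mnm1E eqxx.
- apply: monomial_ideal_sub; first exact: vars_ideal_ideal.
  move=> m [i Si mi]; rewrite (mpolyX_dvd mi); exact: (ideal_mull _ (vars_ideal_ideal S) (vars_ideal_X Si)).
Qed.

(** The variables dividing x^m. *)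
Definition mvars (m : 'X_{1..n}) : {set 'I_n} := [set i | (0 < m i)%N]%SET.

Lemma edge_ideal_dualE (H : hypergraph3 n) :
  edge_ideal_dual K H =
  monomial_ideal (transversal (hedges H) \o mvars).
Proof.
apply/seteqP; split=> f Jf.
- move=> m fm e He; have := Jf e He; rewrite vars_idealE => /(_ m fm)[i ei mi].
  by exists i => //; rewrite inE.
- move=> e He; rewrite vars_idealE => m /Jf /(_ e He)[i ei].
  by rewrite inE => mi; exists i.
Qed.

Lemma doubly_covered_upward (E : {set {set 'I_n}}) : upward (doubly_covered E).
Proof.
move=> m m' [C1 [C2 [T1 T2 le]]]; exists C1, C2; split=> // i.
by rewrite mnmDE (leq_trans (le i)) ?leq_addr.
Qed.

Lemma edge_ideal_dual_sqE (H : hypergraph3 n) :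
  ideal_mul (edge_ideal_dual K H) (edge_ideal_dual K H) =
  monomial_ideal (doubly_covered (hedges H)).
Proof.
rewrite edge_ideal_dualE; apply/seteqP; split.
- apply: smallest_sub; first exact: (monomial_ideal_ideal (@doubly_covered_upward _)).
  move=> _ [u Ju [v Jv <-]] m /msuppM_le/allpairsP[[m1 m2] /= [/Ju T1 /Jv T2 ->]].
  exists (mvars m1), (mvars m2); split=> // i.
  by rewrite !inE mnmDE leq_add //; case: (_ i).
- apply: monomial_ideal_sub => [|m [C1 [C2 [T1 T2 le]]]]; first exact: (ideal_gen_ideal (R := {mpoly K[n]})).
  (* ind C is the exponent of the product of the variables in C. *)
  pose ind (C : {set 'I_n}) : 'X_{1..n} := [multinom (i \in C : nat) | i < n].
  have indT C : transversal (hedges H) C ->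
      monomial_ideal (transversal (hedges H) \o mvars) ('X_[ind C] : {mpoly K[n]}).
    move=> T; apply/monomial_idealX => e /T[i ei Ci].
    by exists i; rewrite // inE mnmE Ci.
  have -> : m = (m - (ind C1 + ind C2) + (ind C1 + ind C2))%MM.
    by rewrite submK //; apply/mnm_lepP => i; rewrite mnmDE !mnmE.
  rewrite !mpolyXD; apply: (ideal_mull _ (ideal_gen_ideal (R := {mpoly K[n]}) _)).
  move=> I [_]; apply; exists 'X_[ind C1]; first exact: indT.
  by exists 'X_[ind C2] => //; exact: indT.
Qed.

Lemma monomial_prime_vars (P : set {mpoly K[n]}) :
  monomial_prime P -> exists S, P = @vars_ideal K n S.
Proof.
case=> /prime_idealP[iP P1 PM] [M defP].
exists [set i | `[< P 'X_i >]]%SET; apply/seteqP; split; last first.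
  by move=> f; apply; split=> // _ [i + <-]; rewrite /= inE => /asboolP.
rewrite {1}defP => f; apply; split; first exact: (ideal_gen_ideal (R := {mpoly K[n]})).
move=> _ [m Mm <-]; rewrite vars_idealE; apply/monomial_idealX.
have : P 'X_[m] by rewrite defP => I [_]; apply; exists m.
(* If no variable dividing x^m lay in P, primality would give 1 in P. *)
rewrite mpolyXE_id => Pm; apply: contrapT => nm; apply: P1.
have {nm} nm i : (0 < m i)%N -> ~ P 'X_i.
  by move=> mi PX; apply: nm; exists i => //; rewrite inE; exact/asboolP.
move: Pm; elim/big_rec: _ => // i x _ IH /PM[|//].
have := nm i; elim: (m i) => [|k IHk] Pi; first by rewrite expr0 => ?; apply: IH; rewrite -[x]mulr1; exact: ideal_mull.
by rewrite exprS => /PM[/(Pi isT)|] //; apply: IHk => _; exact: Pi.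
Qed.

Lemma associated_prime_vars (H : hypergraph3 n) S (a : 'X_{1..n}) :
  prime_ideal (@vars_ideal K n S) -> critical (hedges H) S a ->
  associated_prime (ideal_mul (edge_ideal_dual K H) (edge_ideal_dual K H))
    (@vars_ideal K n S).
Proof.
move=> primeS [ES na aX]; split=> //; exists 'X_[a].
rewrite edge_ideal_dual_sqE monomial_ideal_colon vars_idealE; congr monomial_ideal.
apply/seteqP; split=> m /=.
- case=> i Si mi; have -> : (m + a = (a + U_(i)) + (m - U_(i)))%MM.
    rewrite -addmA [(U_(i) + _)%MM]addmC submK ?[(a + m)%MM]addmC //.
    by apply/mnm_lepP => j; rewrite mnm1E; case: eqP => // <-.
  exact/doubly_covered_upward/aX.
case=> C1 [C2 [T1 T2 le]]; apply: contrapT => nm; apply: na.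
(* The edges lie in S, so transversals may be cut down to S, where m vanishes. *)
have T C : transversal (hedges H) C -> transversal (hedges H) (C :&: S).
  move=> TC e He; have [i ei Ci] := TC e He; exists i => //.
  by rewrite inE Ci (fintype.subsetP (ES e He)).
exists (C1 :&: S), (C2 :&: S); split; try exact: T.
move=> i; rewrite !inE; have [Si|_] := boolP (i \in S); rewrite ?andbF // !andbT.
have := le i; rewrite mnmDE; suff -> : m i = 0%N by [].
by case: (posnP (m i)) => // mi; case: nm; exists i.
Qed.

Lemma associated_prime_card (H : hypergraph3 n) S :
  associated_prime (ideal_mul (edge_ideal_dual K H) (edge_ideal_dual K H))
    (@vars_ideal K n S) -> (2 < #|S|)%N.
Proof.
case=> _ [f]; rewrite edge_ideal_dual_sqE => defS; rewrite ltnNge; apply/negP => S2.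
(* x^m is the square of the product of the variables outside S. *)
pose m : 'X_{1..n} := [multinom ((i \notin S) * 2)%N | i < n].
have : @vars_ideal K n S 'X_[m].
  rewrite defS /= mulrC.
  apply: (ideal_mull _ (monomial_ideal_ideal (@doubly_covered_upward _))).
  apply/monomial_idealX; exists (~: S), (~: S).
  have T : transversal (hedges H) (~: S).
    move=> e He; have : ~~ (e \subset S).
      by apply/negP=> /subset_leq_card; rewrite (hedges_card3 He) leqNgt ltnS S2.
    by case/subsetPn=> i ei Si; exists i; rewrite ?inE.
  by split=> // i; rewrite mnmE inE; case: (_ \notin _).
by rewrite vars_idealE => /monomial_idealX[i Si]; rewrite mnmE Si.
Qed.

End MonomialIdealTheory.

(** * Elimination of a variable *)

(** A ring [R] seen as a polynomial ring A[x] over one of its subrings: [phi]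
rewrites an element of [R] as a polynomial in x, and A is the subring of the
elements c with [phi c = c%:P], called free of x. *)
Section Elimination.
Variables (R : idomainType) (x : R) (phi : {rmorphism R -> {poly R}}).
Hypothesis phi_x : phi x = 'X.
Hypothesis phi_coef : forall f k, phi (phi f)`_k = ((phi f)`_k)%:P.
Hypothesis phi_inj : injective phi.

Implicit Types (P : set R) (f g h : R).

(** One more than the degree in x, and 0 for f = 0. *)
Let deg f := size (phi f).

Let ex_min_deg P : (exists2 f, P f & f != 0) ->
  exists f, [/\ P f, f != 0 & forall g, P g -> g != 0 -> (deg f <= deg g)%N].
Proof.
move=> [f0 Pf0 f0N0].
pose Q d := `[< exists f, [/\ P f, f != 0 & deg f = d] >].
have exQ : exists d, Q d by exists (deg f0); apply/asboolP; exists f0.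
case: (ex_minnP exQ) => d /asboolP[f [Pf fN0 degf]] dmin.
exists f; split=> // g Pg gN0; rewrite degf; apply: dmin; apply/asboolP.
by exists g.
Qed.

(** A nonzero element of [P] of minimal degree in x divides every element of [P]
up to a nonzero factor free of x. *)
Lemma pseudo_divides P h : ideal P -> P h -> h != 0 ->
    (forall g, P g -> g != 0 -> (deg h <= deg g)%N) ->
  forall f, P f -> exists c q, [/\ c != 0, phi c = c%:P & c * f = q * h].
Proof.
move=> iP Ph hN0 hmin f Pf.
have [d] := ubnP (deg f); elim: d f Pf => // d IH f Pf; rewrite ltnS => degf.
have [->|fN0] := eqVneq f 0.
  by exists 1, 0; rewrite oner_neq0 rmorph1 mulr0 mul0r.
have phih : phi h != 0 by rewrite -(rmorph0 phi) (inj_eq phi_inj).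
have phif : phi f != 0 by rewrite -(rmorph0 phi) (inj_eq phi_inj).
pose lh := lead_coef (phi h); pose lf := lead_coef (phi f).
pose k := (deg f - deg h)%N.
(* One step of pseudo-division, cancelling the leading terms. *)
pose r := lh * f - lf * x ^+ k * h.
have Pr : P r.
  by apply: ideal_sub => //; exact: ideal_mull.
have degr : (deg r < d)%N.
  apply: leq_trans degf; rewrite /deg /r rmorphB !rmorphM rmorphXn phi_x !phi_coef.
  have lek : (size (phi h) <= size (phi f))%N by exact: hmin.
  rewrite -[size (phi f)]prednK ?size_poly_gt0 // ltnS; apply/leq_sizeP => j lej.
  rewrite coefB -mulrA !coefCM coefXnM /k /deg.
  move: lej; rewrite leq_eqVlt => /orP[/eqP<-|ltj].
    rewrite ifN -?leqNgt; last by have := size_poly_gt0 (phi h); rewrite phih; lia.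
    have -> : ((size (phi f)).-1 - (size (phi f) - size (phi h)) = (size (phi h)).-1)%N.
      by have := size_poly_gt0 (phi h); rewrite phih; lia.
    by rewrite -!lead_coefE mulrC subrr.
  have lefj : (size (phi f) <= j)%N by lia.
  rewrite ifN; last by lia.
  have lehj : (size (phi h) <= j - (size (phi f) - size (phi h)))%N by lia.
  by rewrite (nth_default 0 lefj) (nth_default 0 lehj) !mulr0 subr0.
have [c [q [cN0 phic cr]]] := IH r Pr degr.
exists (c * lh), (q + c * lf * x ^+ k); split.
- by rewrite mulf_neq0 // lead_coef_eq0.
- by rewrite rmorphM phic phi_coef polyCM.
by rewrite mulrDl -cr /r; ring.
Qed.

(** If p2 met A only in 0, then p1 and p2 would extend to distinct nested nonzero
primes of F[x], for F the field of fractions of A, which is impossible in a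
principal ideal domain.  Pseudo-division avoids forming F. *)
Lemma elimination (p1 p2 : set R) :
    prime_ideal p1 -> prime_ideal p2 -> p1 `<` p2 ->
    (exists2 f, p1 f & f != 0) ->
  exists u, [/\ p2 u, u != 0 & phi u = u%:P].
Proof.
move=> /prime_idealP[i1 _ pr1] /prime_idealP[i2 _ _] [s12 ns21] p1N0.
apply: contrapT => nou.
have p2const c : c != 0 -> phi c = c%:P -> ~ p2 c by move=> c0 cC p2c; apply: nou; exists c.
have [f [p1f fN0 fmin]] := ex_min_deg p1N0.
have [h [p2h hN0 hmin]] : exists h, [/\ p2 h, h != 0 & forall g, p2 g -> g != 0 -> (deg h <= deg g)%N].
  by apply: ex_min_deg; exists f => //; exact: s12.
have pdiv := pseudo_divides i2 p2h hN0 hmin.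
(* p2 contains no nonzero element free of x, so neither p1 nor p2 contains the
   factors c of the pseudo-divisions below. *)
have p1h : p1 h.
  have [c [q [cN0 phic cf]]] := pdiv f (s12 _ p1f).
  have : p1 (q * h) by rewrite -cf; exact: ideal_mull.
  case/pr1 => // p1q; exfalso.
  have cfN0 : c * f != 0 by rewrite mulf_neq0.
  have qN0 : q != 0 by apply: contraNneq cfN0 => q0; rewrite cf q0 mul0r.
  have phiN0 g : g != 0 -> phi g != 0 by rewrite -(rmorph0 phi) (inj_eq phi_inj).
  have size_h : (1 < deg h)%N.
    rewrite ltnNge; apply/negP => /size1_polyC hC; apply: (p2const h) => //.
    have hE : h = (phi h)`_0 by apply: phi_inj; rewrite phi_coef.
    by rewrite {1}hC -hE.
  have := fmin q p1q qN0; have /(congr1 (fun g => deg g)) := cf.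
  rewrite /deg !rmorphM phic mul_polyC size_scale // size_mul ?phiN0 //.
  by move: size_h; rewrite /deg => size_h ->; have := phiN0 q qN0; rewrite -size_poly_gt0; lia.
apply: ns21 => g p2g; have [c [q [cN0 phic cg]]] := pdiv g p2g.
have : p1 (c * g) by rewrite cg; exact: ideal_mull.
by case/pr1 => // /s12 /(p2const c cN0 phic).
Qed.

End Elimination.

(** * The height of an ideal generated by variables *)

Section Height.
Variables (K : fieldType) (n : nat).
Implicit Types (S : {set 'I_n}) (f g u : {mpoly K[n]}).

Lemma mpoly_ring_ind (Q : {mpoly K[n]} -> Prop) :
    (forall c, Q c%:MP) -> (forall i, Q 'X_i) ->
    (forall f g, Q f -> Q g -> Q (f + g)) ->
    (forall f g, Q f -> Q g -> Q (f * g)) ->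
  forall f, Q f.
Proof.
move=> QC QX QD QM; elim/mpolyind => [|c m f _ _ Qf]; first by rewrite -mpolyC0.
apply: (QD) => //; rewrite -mul_mpolyC; apply: (QM) => //; rewrite mpolyXE_id.
elim/big_ind: _ => // [|i _]; first by rewrite -mpolyC1.
elim: (m i) => [|k IH]; first by rewrite expr0 -mpolyC1.
by rewrite exprS; exact: QM.
Qed.

Lemma mpoly_rmorph_eq (R : nzRingType) (F G : {rmorphism {mpoly K[n]} -> R}) :
  (forall c, F c%:MP = G c%:MP) -> (forall i, F 'X_i = G 'X_i) -> F =1 G.
Proof.
move=> FC FX; elim/mpoly_ring_ind => // f g Ff Fg.
- by rewrite !rmorphD Ff Fg.
- by rewrite !rmorphM Ff Fg.
Qed.

(** Substitution of 0 for the variables of [S]; its kernel is [vars_ideal S], and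
its fixed points are the polynomials free of the variables of [S]. *)
Definition kill_vars S : {mpoly K[n]} -> {mpoly K[n]} :=
  mmap (@mpolyC n K) (fun i => if i \in S then 0 else 'X_i).

HB.instance Definition _ S := GRing.RMorphism.on (kill_vars S).

Lemma kill_varsD S : {morph kill_vars S : f g / f + g}.
Proof. exact: rmorphD. Qed.

Lemma kill_varsM S : {morph kill_vars S : f g / f * g}.
Proof. exact: rmorphM. Qed.

Lemma kill_varsC S c : kill_vars S c%:MP = c%:MP.
Proof. exact: mmapC. Qed.

Lemma kill_varsX S i : kill_vars S 'X_i = if i \in S then 0 else 'X_i.
Proof. by rewrite /kill_vars mmapX mmap1U. Qed.

Lemma kill_vars_sub S f : (@vars_ideal K n S) (f - kill_vars S f).
Proof.
have iS := @vars_ideal_ideal K n S.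
elim/mpoly_ring_ind: f => [c|i|f g Sf Sg|f g Sf Sg].
- by rewrite kill_varsC subrr; case: iS.
- rewrite kill_varsX; case: ifP => Si; last by rewrite subrr; case: iS.
  by rewrite subr0; exact: vars_ideal_X.
- by rewrite rmorphD opprD addrACA; exact: (ideal_add iS).
have -> : f * g - kill_vars S (f * g) =
    g * (f - kill_vars S f) + kill_vars S f * (g - kill_vars S g).
  by rewrite rmorphM; ring.
by apply: (ideal_add iS); apply: (ideal_mull _ iS).
Qed.

Lemma vars_ideal_kill S f : @vars_ideal K n S f <-> kill_vars S f = 0.
Proof.
split=> [|f0]; last by have := @kill_vars_sub S f; rewrite f0 subr0.
apply: (@smallest_sub _ _ _ [set f | kill_vars S f = 0]).
  split=> [|a u v /= u0 v0]; first exact: rmorph0.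
  by rewrite rmorphD rmorphM /= u0 v0 mulr0 addr0.
by move=> _ [i Si <-] /=; rewrite kill_varsX Si.
Qed.

Lemma vars_ideal_prime S : prime_ideal (@vars_ideal K n S).
Proof.
apply/prime_idealP; split=> [||f g]; first exact: vars_ideal_ideal.
  by move/vars_ideal_kill; rewrite rmorph1; apply/eqP/oner_neq0.
move/vars_ideal_kill; rewrite rmorphM => /eqP; rewrite mulf_eq0.
by case/orP=> /eqP ?; [left|right]; apply/vars_ideal_kill.
Qed.

Lemma vars_ideal_memX S i : @vars_ideal K n S 'X_i <-> i \in S.
Proof.
split; last exact: vars_ideal_X.
rewrite vars_idealE => /monomial_idealX[j Sj]; rewrite mnm1E.
by case: eqP => [->|].
Qed.

Lemma vars_ideal_subset S (S' : {set 'I_n}) :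
  S \subset S' -> @vars_ideal K n S `<=` @vars_ideal K n S'.
Proof.
move=> /fintype.subsetP SS'; apply: smallest_sub; first exact: vars_ideal_ideal.
by move=> _ [i /SS' S'i <-]; exact: vars_ideal_X.
Qed.

Lemma height_vars_ideal_ge S : height_ge (@vars_ideal K n S) #|S|.
Proof.
exists #|S| => //.
pose A k : {set 'I_n} := [set i in take k (enum S)]%SET.
exists (fun k => @vars_ideal K n (A k)); split=> [i _|k ltk|].
- exact: vars_ideal_prime.
- have ltkS : (k < size (enum S))%N by rewrite -cardE.
  have [i0 _] : exists i, i \in S.
    by apply/set0Pn; rewrite -card_gt0 (leq_ltn_trans _ ltk).
  pose i := nth i0 (enum S) k.
  have Ai : i \in A k.+1 by rewrite inE (take_nth i0) // mem_rcons mem_head.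
  split=> [|sub].
    apply: vars_ideal_subset; apply/fintype.subsetP => j.
    by rewrite !inE (take_nth i0) // mem_rcons inE orbC => ->.
  have /sub/vars_ideal_memX := vars_ideal_X (K := K) Ai.
  by rewrite inE in_take_leq ?index_uniq ?enum_uniq ?ltnn // ltnW.
- suff -> : A #|S| = S by [].
  by apply/finset.setP => i; rewrite inE cardE take_size mem_enum.
Qed.

(** A polynomial seen as a univariate polynomial in x_j.  The coefficients are
kept in the whole ring; [as_poly_in_coef] says that they are free of x_j. *)
Definition as_poly_in (j : 'I_n) : {mpoly K[n]} -> {poly {mpoly K[n]}} :=
  mmap (polyC \o @mpolyC n K) (fun i => if i == j then 'X else ('X_i)%:P).

HB.instance Definition _ j := GRing.RMorphism.on (as_poly_in j).

Lemma as_poly_inC j c : as_poly_in j c%:MP = (c%:MP)%:P.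
Proof. by rewrite /as_poly_in mmapC. Qed.

Lemma as_poly_inX j i : as_poly_in j 'X_i = if i == j then 'X else ('X_i)%:P.
Proof. by rewrite /as_poly_in mmapX mmap1U. Qed.

Lemma as_poly_in0 j : as_poly_in j 0 = 0.
Proof. exact: rmorph0. Qed.

Lemma as_poly_inD j : {morph as_poly_in j : f g / f + g}.
Proof. exact: rmorphD. Qed.

Lemma as_poly_inM j : {morph as_poly_in j : f g / f * g}.
Proof. exact: rmorphM. Qed.

Lemma as_poly_inK j f : (as_poly_in j f).['X_j] = f.
Proof.
elim/mpoly_ring_ind: f => [c|i|f g|f g].
- by rewrite as_poly_inC hornerC.
- by rewrite as_poly_inX; case: eqP => [->|_]; rewrite ?hornerX ?hornerC.
- rewrite as_poly_inD hornerD; move: (as_poly_in j f) (as_poly_in j g) => F G.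
  by move=> -> ->.
- rewrite as_poly_inM hornerM; move: (as_poly_in j f) (as_poly_in j g) => F G.
  by move=> -> ->.
Qed.

Lemma as_poly_in_inj j : injective (as_poly_in j).
Proof. by move=> f g eq_fg; rewrite -[f](as_poly_inK j) eq_fg as_poly_inK. Qed.

Lemma as_poly_in_horner0 j f : (as_poly_in j f).[0] = kill_vars [set j]%SET f.
Proof.
elim/mpoly_ring_ind: f => [c|i|f g|f g].
- by rewrite as_poly_inC hornerC kill_varsC.
- by rewrite as_poly_inX kill_varsX inE; case: eqP => _; rewrite ?hornerX ?hornerC.
- rewrite as_poly_inD hornerD kill_varsD.
  by move: (as_poly_in j f) (as_poly_in j g) => F G -> ->.
- rewrite as_poly_inM hornerM kill_varsM.
  by move: (as_poly_in j f) (as_poly_in j g) => F G -> ->.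
Qed.

Lemma as_poly_in_coef j f k :
  as_poly_in j (as_poly_in j f)`_k = ((as_poly_in j f)`_k)%:P.
Proof.
elim/mpoly_ring_ind: f k => [c|i|f g Hf Hg|f g Hf Hg] k.
- by rewrite as_poly_inC coefC; case: eqP; rewrite ?as_poly_inC ?as_poly_in0.
- rewrite as_poly_inX; case: eqVneq => [_|neq]; last first.
    by rewrite coefC; case: eqP; rewrite ?as_poly_inX ?(negbTE neq) ?as_poly_in0.
  by rewrite coefX (rmorph_nat (as_poly_in j)) polyC_natr.
- move: (as_poly_in j f) (as_poly_in j g) Hf Hg (as_poly_inD j f g) => F G Hf Hg ->.
  by rewrite coefD as_poly_inD Hf Hg polyCD.
move: (as_poly_in j f) (as_poly_in j g) Hf Hg (as_poly_inM j f g) => F G Hf Hg ->.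
rewrite coefM (rmorph_sum (as_poly_in j)) (rmorph_sum polyC).
by apply: eq_bigr => i _; rewrite /= as_poly_inM Hf Hg polyCM.
Qed.

Lemma kill_varsU1 i S f :
  kill_vars (i |: S) f = kill_vars [set i]%SET (kill_vars S f).
Proof.
apply: (mpoly_rmorph_eq (F := kill_vars (i |: S)) (G := kill_vars [set i]%SET \o kill_vars S)) => /= [c|j].
  by rewrite !kill_varsC.
rewrite !kill_varsX !inE; have [Sj|Sj] := boolP (j \in S); last first.
  by rewrite orbF kill_varsX inE.
by rewrite orbT rmorph0.
Qed.

Lemma vars_ideal1 i f : @vars_ideal K n [set i]%SET f -> exists w, f = 'X_i * w.
Proof.
apply: (@smallest_sub _ _ _ [set f | exists w, f = 'X_i * w]).
  split=> [|a _ _ [u ->] [v ->]]; first by exists 0; rewrite mulr0.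
  by exists (a * u + v); ring.
by move=> _ [j /set1P-> <-]; exists 1; rewrite mulr1.
Qed.

Lemma mpolyX_neq0 (m : 'X_{1..n}) : 'X_[m] != 0 :> {mpoly K[n]}.
Proof. by rewrite -msupp_eq0 msuppX. Qed.

Lemma msize_X_mul i f : f != 0 -> msize ('X_i * f) = (msize f).+1.
Proof.
by move=> f0; rewrite (msizeM (mpolyX_neq0 _) f0) msizeX mdeg1.
Qed.

(** A nonzero element of [P] free of all the variables of [S] but x_i is a
multiple of x_i by such an element, of smaller degree, hence descent applies. *)
Lemma mem_var_of_free S i (P : set {mpoly K[n]}) u :
    prime_ideal P -> P `<=` @vars_ideal K n S -> i \in S ->
    P u -> u != 0 -> kill_vars (S :\ i) u = u ->
  P 'X_i.
Proof.
move=> /prime_idealP[iP _ PM] PS Si.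
have [d] := ubnP (msize u); elim: d u => // d IH u; rewrite ltnS => ud Pu uN0 uE.
have [w defu] : exists w, u = 'X_i * w.
  apply/vars_ideal1/vars_ideal_kill.
  rewrite -{1}uE -kill_varsU1 (finset.setD1K Si).
  apply/vars_ideal_kill; exact: PS u Pu.
have wN0 : w != 0 by apply: contraNneq uN0 => w0; rewrite defu w0 mulr0.
have : P ('X_i * w) by rewrite -defu.
case/PM => // Pw; apply: (IH w) => //.
  by apply: leq_trans ud; rewrite defu msize_X_mul.
apply: (@mulfI _ ('X_i : {mpoly K[n]})); first exact: mpolyX_neq0.
have : kill_vars (S :\ i) 'X_i = 'X_i by rewrite kill_varsX !inE eqxx.
by move=> XE; rewrite -{1}XE -rmorphM -defu.
Qed.

Lemma height_vars_ideal_le S : height_ge (@vars_ideal K n S) 3 -> (2 < #|S|)%N.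
Proof.
case=> h h3 [p [pr lt ph]]; rewrite ltnNge; apply/negP => S2.
(* p k.+1 < p k.+2 < P_S are the last three terms of the chain. *)
have [k defh] : exists k, h = k.+3 by exists (h - 3)%N; lia.
rewrite {h}defh in h3 pr lt ph.
have [f p1f fN0] : exists2 f, p k.+1 f & f != 0.
  have [_ nsub] := lt k (ltnW (ltnW (ltnSn _))).
  have /prime_idealP[[p0 _] _ _] := pr k (ltnW (ltnW (ltnW (ltnSn _)))).
  apply: contrapT => nof; apply: nsub => f p1f.
  by have [->//|fN0] := eqVneq f 0; case: nof; exists f.
have pr1 := pr k.+1 (ltnW (ltnW (ltnSn _))).
have pr2 := pr k.+2 (ltnW (ltnSn _)).
have lt12 := lt k.+1 (ltnW (ltnSn _)).
have [s2S ns2S] := lt k.+2 (ltnSn _); rewrite ph in s2S ns2S.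
apply: ns2S; apply: smallest_sub; first by case/prime_idealP: pr2.
move=> _ [i Si <-] /=; rewrite /= in Si.
have [u [p2u uN0 uE]] : exists u, [/\ p k.+2 u, u != 0 & kill_vars (S :\ i) u = u].
  have : (#|S :\ i| <= 1)%N by have := cardsD1 i S; rewrite Si; lia.
  have [->|/set0Pn[j Sj]] := eqVneq (S :\ i) finset.set0.
    exists f; split=> //; first by case: lt12 => s12 _; exact: s12.
    apply: (mpoly_rmorph_eq (F := kill_vars finset.set0) (G := idfun)) => /= [c|j].
      by rewrite kill_varsC.
    by rewrite kill_varsX inE.
  rewrite (cardsD1 j) Sj add1n ltnS leqn0 cards_eq0 => /eqP S0.
  have -> : S :\ i = [set j]%SET by rewrite -(finset.setD1K Sj) S0 finset.setU0.
  have [||u [p2u uN0 uE]] := @elimination _ 'X_j (as_poly_in j) _ (as_poly_in_coef j)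
    (@as_poly_in_inj j) _ _ pr1 pr2 lt12.
  - by rewrite /= as_poly_inX eqxx.
  - by exists f.
  by exists u; split=> //; rewrite -as_poly_in_horner0 [as_poly_in j u]uE hornerC.
exact: (mem_var_of_free pr2 s2S Si p2u).
Qed.

End Height.

Theorem theorem2p3 (K : fieldType) (n : nat) (P : set {mpoly K[n]})
    (hP : monomial_prime P) :
  (exists H : hypergraph3 n,
     associated_prime (ideal_mul (edge_ideal_dual K H) (edge_ideal_dual K H)) P)
  <-> height_ge P 3.
Proof.
have [S ->] := monomial_prime_vars hP; split=> [[H /associated_prime_card S3]|].
  by have [h leh ch] := height_vars_ideal_ge K S; exists h => //; exact: leq_trans leh.
move/height_vars_ideal_le/critical_exists=> [H [a crit]].
by exists H; apply: associated_prime_vars crit; exact: vars_ideal_prime.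
Qed.
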